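(* Let $\pi\colon (T,X)\to (T,Y)$ be an extension of minimal compact semiflows, where $T$ is a discrete monoid (in particular this covers the case that $T$ is a discrete group). Suppose $L\subseteq \mathtt{R}_\pi$ is a closed $T$-invariant AP-transitive relation for $\pi$ on $X$ such that (a) $L$ contains a dense set of a.p. points of the semiflow $(T,L)$, and (b) $\mathtt{RP}_{\pi|L}=L$. Then $(T,L)$ is an M-semiflow, i.e. it is topologically transitive and has a dense set of a.p. points.
   Context: An extension $\pi\colon(T,X)\to(T,Y)$ is a continuous surjection with $\pi(tx)=t\pi(x)$ for all $t\in T$, $x\in X$. Put $\mathtt{R}_\pi=\{(x_1,x_2)\in X\times X:\pi x_1=\pi x_2\}$, on which $T$ acts diagonally, and let $\Delta_X$ denote the diagonal of $X\times X$. A subset $A\subseteq T$ is syndetic if there is a compact (here: finite) $K\subseteq T$ with $Kt\cap A\neq\emptyset$ for all $t\in T$. A point $z$ of a dynamic $(T,Z)$ is almost periodic (a.p.) if $\{t\in T: tz\in U\}$ is syndetic for every neighborhood $U$ of $z$. A dynamic $(T,Z)$ is topologically transitive (T.T.) if for all nonempty open $U,V\subseteq Z$ there is $t\in T$ with $V\cap tU\neq\emptyset$. A dynamic is an M-dynamic (M-semiflow, M-flow) if it is T.T. and has a dense set of a.p. points. A nonempty set $L\subseteq\mathtt{R}_\pi$ is an AP-transitive relation for $\pi$ on $X$ if $L$ is reflexive and symmetric as a relation on $X$, and whenever $(x_1,x_2)\in L$ and $(x_2,x_3)\in L$ are both a.p. points of $(T,X\times X)$, then $(x_1,x_3)\in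 L$. For $L\subseteq\mathtt{R}_\pi$, $\mathtt{RP}_{\pi|L}$ is the set of $\tilde x\in L$ for which there exist nets $\tilde x_j\in L$, $t_j\in T$ and a point $\tilde x'\in\Delta_X$ with $\tilde x_j\to\tilde x$ and $t_j\tilde x_j\to\tilde x'$. *)

(* Defs.v *)
From HB Require Import structures.
From mathcomp Require Import all_boot all_order.
From mathcomp Require Import all_classical all_reals all_analysis.
Set Implicit Arguments. Unset Strict Implicit. Unset Printing Implicit Defensive.
Import boolp.
Local Open Scope classical_set_scope.

(* A discrete monoid (T, mul, e) is given by explicit operations; its
   axioms are assumed in the theorem.  A semiflow of T on a space Z is a map
   act : T -> Z -> Z with act e = id, act (s*t) = act s \o act t, and each
   act t continuous (T is discrete). *)

Definition monoid_axioms (T : Type) (mul : T -> T -> T) (e : T) : Prop :=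
  (forall a b c, mul a (mul b c) = mul (mul a b) c) /\
  (forall a, mul e a = a) /\ (forall a, mul a e = a).

Definition semiflow (T : Type) (mul : T -> T -> T) (e : T) (Z : topologicalType)
  (act : T -> Z -> Z) : Prop :=
  (forall z, act e z = z) /\
  (forall s t z, act (mul s t) z = act s (act t z)) /\
  (forall t, continuous (act t)).

Definition sf_invariant (T : Type) (Z : Type) (act : T -> Z -> Z) (A : set Z) : Prop :=
  forall t z, A z -> A (act t z).

Definition sf_minimal (T : Type) (Z : topologicalType) (act : T -> Z -> Z) : Prop :=
  forall A : set Z, closed A -> sf_invariant act A -> A !=set0 -> A = setT.

Definition sf_extension (T : Type) (X Y : topologicalType)
  (actX : T -> X -> X) (actY : T -> Y -> Y) (pi : X -> Y) : Prop :=
  continuous pi /\ (forall y, exists x, pi x = y) /\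
  (forall t x, pi (actX t x) = actY t (pi x)).

Definition Rpi (X Y : Type) (pi : X -> Y) : set (X * X) :=
  [set p | pi p.1 = pi p.2].

Definition sf_diagonal (X : Type) : set (X * X) := [set p | p.1 = p.2].

Definition diag_act (T X : Type) (act : T -> X -> X) (t : T) (p : X * X) : X * X :=
  (act t p.1, act t p.2).

Definition sf_syndetic (T : Type) (mul : T -> T -> T) (A : set T) : Prop :=
  exists K : set T, finite_set K /\ forall t, exists2 k, K k & A (mul k t).

Definition ap_point (T : Type) (mul : T -> T -> T) (Z : topologicalType)
  (act : T -> Z -> Z) (z : Z) : Prop :=
  forall U : set Z, nbhs z U -> sf_syndetic mul [set t | U (act t z)].

Definition rel_open (Z : topologicalType) (L U : set Z) : Prop :=
  exists O : set Z, open O /\ U = O `&` L.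

Definition top_transitive_on (T : Type) (Z : topologicalType)
  (act : T -> Z -> Z) (L : set Z) : Prop :=
  forall U V : set Z, rel_open L U -> rel_open L V -> U !=set0 -> V !=set0 ->
    exists t, V `&` (act t @` U) !=set0.

Definition dense_ap_on (T : Type) (mul : T -> T -> T) (Z : topologicalType)
  (act : T -> Z -> Z) (L : set Z) : Prop :=
  exists D : set Z, D `<=` L /\ (forall z, D z -> ap_point mul act z) /\
    L `<=` closure D.

Definition M_semiflow_on (T : Type) (mul : T -> T -> T) (Z : topologicalType)
  (act : T -> Z -> Z) (L : set Z) : Prop :=
  top_transitive_on act L /\ dense_ap_on mul act L.

Definition AP_transitive (T : Type) (mul : T -> T -> T) (X Y : topologicalType)
  (actX : T -> X -> X) (pi : X -> Y) (L : set (X * X)) : Prop :=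
  L !=set0 /\ L `<=` Rpi pi /\
  (forall x, L (x, x)) /\
  (forall x1 x2, L (x1, x2) -> L (x2, x1)) /\
  (forall x1 x2 x3, L (x1, x2) -> L (x2, x3) ->
     ap_point mul (diag_act actX) (x1, x2) ->
     ap_point mul (diag_act actX) (x2, x3) -> L (x1, x3)).

(* RP_{pi|L}: nets (x_j, t_j) are represented by proper filters on
   (X*X) * T; "x_j ∈ L" holds eventually (pass to a tail of the net). *)
Definition RP_rel (T : Type) (X : topologicalType) (actX : T -> X -> X)
  (L : set (X * X)) : set (X * X) :=
  [set p | L p /\
    exists F : set_system ((X * X) * T), ProperFilter F /\
      F [set q | L q.1] /\
      (fun q => q.1) @ F --> p /\
      exists2 p' : X * X, @sf_diagonal X p' &
        (fun q => diag_act actX q.2 q.1) @ F --> p'].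

(* Main.v *)
Require Import Defs.
From HB Require Import structures.
From mathcomp Require Import all_boot all_order.
From mathcomp Require Import all_classical all_reals all_analysis.
Set Implicit Arguments. Unset Strict Implicit. Unset Printing Implicit Defensive.
Local Open Scope classical_set_scope.

(* Let I be a minimal left ideal of the Ellis semigroup of X.  A point is almost
   periodic iff some idempotent of I fixes it, and for such an idempotent u,
   AP-transitivity makes L an equivalence relation between points fixed by u.
   For transitivity, let N be a closed invariant set with G /\ L <= N for some
   open G meeting L; we show that N contains every almost periodic (x1, x2) in L.
   Pick an almost periodic (p, q) in G /\ L and an idempotent u of I fixing it.
   An element of the Ellis semigroup moves (x1, x2) to some (p, z) fixed by u, so
   it suffices to find (p, z) in N.  Now (q, z) is in L, hence regionally
   proximal: minimality and the density of almost periodic pairs give g_j in I,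
   t_j in T and w_j fixed by u with (q, w_j) in L, g_j (q, w_j) -> (q, z) and
   t_j g_j (q, w_j) -> (q, q).  By compactness g_j -> r and t_j g_j -> r' in I,
   with r q = r' q = q.  Let c be the inverse of u r in the group u I, so that
   c q = q.  Then t_j g_j (c p, w_j) -> r' c (p, q), whose orbit meets G, so
   (c p, w_j) is eventually in N; hence so is lim g_j (c p, w_j) = (r c p, z), and
   applying u gives (p, z) in N. *)

Lemma continuous_pair (W X Y : topologicalType) (f : W -> X) (g : W -> Y) :
  continuous f -> continuous g -> continuous (fun w => (f w, g w)).
Proof. by move=> cf cg w; apply: cvg_pair; [exact: cf|exact: cg]. Qed.

Lemma continuous_fst (X Y : topologicalType) : continuous (@fst X Y).
Proof. by move=> x; exact: cvg_fst. Qed.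

Lemma continuous_snd (X Y : topologicalType) : continuous (@snd X Y).
Proof. by move=> x; exact: cvg_snd. Qed.

Lemma continuous_compT (W X Y : topologicalType) (f : W -> X) (g : X -> Y) :
  continuous f -> continuous g -> continuous (g \o f).
Proof. by move=> cf cg w; apply: continuous_comp; [exact: cf|exact: cg]. Qed.

Lemma nbhs_cluster_continuous (W Z : topologicalType) (f : W -> Z) (x y : W) :
  continuous f -> cluster (nbhs x) y -> cluster (nbhs (f x)) (f y).
Proof.
by move=> cf cl A B /cf nA /cf nB; have [z [Az Bz]] := cl _ _ nA nB; exists (f z).
Qed.

Lemma hausdorff_prod (W Z : topologicalType) :
  hausdorff_space W -> hausdorff_space Z -> hausdorff_space (W * Z)%type.
Proof.
move=> hW hZ [a b] [c d] cl; congr pair; [apply: hW|apply: hZ].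
- exact: nbhs_cluster_continuous (@continuous_fst _ _) cl.
- exact: nbhs_cluster_continuous (@continuous_snd _ _) cl.
Qed.

Lemma compact_prod (W Z : topologicalType) :
  compact [set: W] -> compact [set: Z] -> compact [set: W * Z].
Proof. by rewrite -setXTT; exact: compact_setX. Qed.

Lemma closed_compactT (Z : topologicalType) (A : set Z) :
  compact [set: Z] -> closed A -> compact A.
Proof. by move=> cZ cA; exact: subclosed_compact cA cZ _. Qed.

Lemma compact_image_closed (W Z : topologicalType) (f : W -> Z) (A : set W) :
  hausdorff_space Z -> compact A -> continuous f -> closed (f @` A).
Proof.
move=> hZ cA cf; apply: compact_closed => //; apply: continuous_compact => //.
exact: continuous_subspaceT.
Qed.

Lemma closure_image_subset (W Z : topologicalType) (f : W -> Z) (A : set W) :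
  hausdorff_space Z -> compact [set: W] -> continuous f ->
  closure (f @` A) `<=` f @` closure A.
Proof.
move=> hZ cW cf.
have /closure_id -> : closed (f @` closure A).
  apply: compact_image_closed => //.
  exact: closed_compactT cW (@closed_closure _ _).
by apply/closureS/image_subset/subset_closure.
Qed.

Lemma closure_sub_closed (Z : topologicalType) (A B : set Z) :
  closed B -> A `<=` B -> closure A `<=` B.
Proof. by move=> /closure_id{2}-> /closureS. Qed.

Lemma continuous_closure_preimage (W Z : topologicalType) (f : W -> Z)
    (A : set W) (B : set Z) :
  continuous f -> A `<=` f @^-1` B -> closure A `<=` f @^-1` closure B.
Proof.
move=> /continuous_closedP cf AB; apply: closure_sub_closed.
  by apply: cf; exact: closed_closure.
by move=> w Aw; apply: subset_closure; exact: AB.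
Qed.

Lemma closure_open_setI (Z : topologicalType) (A O : set Z) (z : Z) :
  open O -> closure A z -> O z -> closure (A `&` O) z.
Proof.
move=> oO clA Oz B nB; rewrite -setIA; apply: clA.
by apply: filterI => //; exact: open_nbhs_nbhs.
Qed.

Lemma compact_finite_subcover (Z : topologicalType) (I : Type) (U : I -> set Z)
    (A : set Z) :
  compact A -> (forall i, open (U i)) -> A `<=` \bigcup_i U i ->
  exists2 K : set I, finite_set K & A `<=` \bigcup_(i in K) U i.
Proof.
move=> /compact_near_coveringP covA oU AU.
pose F := filter_from (@finite_set I)
  (fun K => [set J | finite_set J /\ K `<=` J]).
have FF : Filter F.
  apply: filter_from_filter; first by exists set0.
  move=> K J fK fJ; exists (K `|` J); first by rewrite finite_setU.
  by move=> H [fH]; rewrite subUset => -[KH JH].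
have [|K fK KU] := covA _ F (fun K z => exists2 i, K i & U i z) FF.
  move=> z /AU[i _ Uz].
  exists (U i, [set K : set I | K i]); last by move=> [w K] /= [Uw Ki]; exists i.
  split=> /=; first exact: open_nbhs_nbhs.
  by exists [set i] => [|K [_]]; [exact: finite_set1|apply].
by exists K => //; exact: (KU K (conj fK (@subset_refl _ K))).
Qed.

Lemma closed_chain_bigcap_neq0 (Z : topologicalType) (F : set (set Z)) :
  compact [set: Z] -> F !=set0 -> total_on F subset ->
  (forall B, F B -> closed B /\ B !=set0) -> \bigcap_(B in F) B !=set0.
Proof.
move=> cZ F0 totF clF.
have FF : ProperFilter (filter_from F id).
  apply: filter_from_proper; last by move=> B /clF[].
  apply: filter_from_filter => // B C FB FC.
  by have [/setIidl BC|/setIidr BC] := totF _ _ FB FC;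
    [exists B|exists C]; rewrite ?BC.
have [|z [_ clz]] := cZ (filter_from F id) FF.
  by have [B FB] := F0; exists B.
by exists z => B FB; apply: (clF B FB).1 => C /clz; apply; exists B.
Qed.

Lemma exists_minimal_closed (Z : topologicalType) (Q : set (set Z)) (A : set Z) :
  compact [set: Z] -> (forall B, Q B -> closed B) ->
  (forall F, F !=set0 -> F `<=` Q -> Q (\bigcap_(B in F) B)) ->
  Q A -> A !=set0 ->
  exists B, [/\ Q B, B !=set0, B `<=` A &
    forall C, Q C -> C !=set0 -> C `<=` B -> C = B].
Proof.
move=> cZ Qcl Qcap QA A0.
pose S := {B | [/\ Q B, B !=set0 & B `<=` A]}.
pose R (B C : S) := `[< sval C `<=` sval B >].
have [|B C D|[B SB] [C SC]|F totF|[B [QB B0 BA]] Bmin] := @Zorn S R.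
- by move=> B; exact/asboolP.
- by move=> /asboolP CB /asboolP DC; apply/asboolP; exact: subset_trans CB.
- by move=> /asboolP CB /asboolP BC; exact/eq_exist/seteqP.
- have [->|F0] := eqVneq F set0.
    by exists (exist _ A (And3 QA A0 (@subset_refl _ A))).
  pose M := \bigcap_(B in [set sval B | B in F]) B.
  have SM : [/\ Q M, M !=set0 & M `<=` A].
    have {}F0 : [set sval B | B in F] !=set0 by exact/image_nonempty/set0P.
    split.
    + by apply: Qcap => // _ [[B [QB B0 BA]] _ <-].
    + apply: closed_chain_bigcap_neq0 => // [_ _ [B FB <-] [C FC <-]|].
        by case: (totF _ _ FB FC) => /asboolP; [right|left].
      by move=> _ [[B [QB B0 BA]] _ <-]; split=> //; exact: Qcl.
    + move: F0 => [_ [B FB _]] z Mz; case: (svalP B) => _ _; apply.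
      by apply: Mz; exists B.
  exists (exist _ M SM) => B FB; apply/asboolP => /= z; apply.
  by exists B.
exists B; split=> // C QC C0 CB.
have SC : [/\ Q C, C !=set0 & C `<=` A] by split=> //; exact: subset_trans CB BA.
have := Bmin (exist _ C SC).
by rewrite /R/= => /(_ (asboolT CB)) [].
Qed.

Section PointwiseTopology.
Context (U : eqType) (Z : topologicalType).

Lemma hausdorff_ptws : hausdorff_space Z -> hausdorff_space {ptws U -> Z}.
Proof. by move=> hZ; exact: (@hausdorff_product U (fun _ => Z)). Qed.

Lemma compact_ptws : compact [set: Z] -> compact [set: {ptws U -> Z}].
Proof.
move=> cZ; have := @tychonoff U (fun _ => Z) (fun _ => setT) (fun _ => cZ).
by congr compact; rewrite eqEsubset; split.
Qed.

Lemma ptws_eval_continuous (x : U) : continuous (fun f : {ptws U -> Z} => f x).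
Proof. exact: (@proj_continuous U (fun _ => Z) x). Qed.

Lemma continuous_ptws (W : topologicalType) (h : W -> {ptws U -> Z}) :
  (forall x, continuous (fun w => h w x)) -> continuous h.
Proof.
move=> ch w; apply/cvg_sup => x; apply/cvg_image.
  by rewrite eqEsubset; split=> z // _; exists (fun=> z).
move=> A /= /(ch x w) hA; rewrite nbhs_simpl /=.
exists (@^~ x @^-1` A); first exact: hA.
by rewrite image_preimage // eqEsubset; split=> z // _; exists (fun=> z).
Qed.

End PointwiseTopology.

Section Semiflow.
Context (T : Type) (mul : T -> T -> T) (e : T) (Z : topologicalType).
Context (act : T -> Z -> Z).
Hypothesis flow : semiflow mul e act.

Lemma semiflow1 z : act e z = z.
Proof. by case: flow. Qed.

Lemma semiflowM s t : act (mul s t) = act s \o act t.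
Proof. by apply/funext => z; case: flow => _ [/(_ s t z)]. Qed.

Lemma semiflow_continuous t : continuous (act t).
Proof. by case: flow => _ []. Qed.

Lemma top_transitive_on_closed_invariant (L : set Z) :
  sf_invariant act L ->
  (forall N G, closed N -> sf_invariant act N -> open G -> G `&` L !=set0 ->
     G `&` L `<=` N -> L `<=` N) ->
  top_transitive_on act L.
Proof.
move=> iL LN U V [G [oG ->]] [H [oH ->]] GL0 [z [Hz Lz]].
apply: contrapT => noreturn.
pose N := \bigcap_t [set x | ~ H (act t x)].
suff /(_ z Lz e I) : L `<=` N by rewrite /= semiflow1.
apply: LN oG GL0 _.
- apply: closed_bigI => t _.
  apply: (continuous_closedP (act t)).1 (~` H) _.
    exact: semiflow_continuous.
  exact: open_closedC.
- by move=> t x Nx s _ /=; have := Nx (mul s t) I; rewrite semiflowM.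
- move=> x [Gx Lx] t _ /= Hx; apply: noreturn; exists t, (act t x).
  by split; [split=> //; exact: iL|exists x].
Qed.

Definition orbit_graph (A : set Z) : set (Z * Z) :=
  [set (z, act t z) | z in A & t in [set: T]].

Lemma closure_orbit_graph_invariant (A : set Z) (z : Z) :
  sf_invariant act [set x | closure (orbit_graph A) (z, x)].
Proof.
move=> s x; have cf : continuous (fun y : Z * Z => (y.1, act s y.2)).
  apply: continuous_pair; first exact: continuous_fst.
  exact: continuous_compT (@continuous_snd _ _) (@semiflow_continuous s).
apply: (continuous_closure_preimage cf) => _ [y Ay [t _ <-]].
by exists y => //; exists (mul s t) => //; rewrite semiflowM.
Qed.

Lemma closure_orbit_graph_closure (A : set Z) :
  closure (orbit_graph (closure A)) `<=` closure (orbit_graph A).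
Proof.
apply: closure_sub_closed; first exact: closed_closure.
move=> _ [z clz [t _ <-]].
have cf : continuous (fun y => (y, act t y)).
  by apply: continuous_pair; [move=> y; exact: cvg_id|exact: semiflow_continuous].
apply: (continuous_closure_preimage cf) clz => y Ay.
by exists y => //; exists t.
Qed.

End Semiflow.

Lemma diag_semiflow (T : Type) (mul : T -> T -> T) (e : T) (X : topologicalType)
    (act : T -> X -> X) :
  semiflow mul e act -> semiflow mul e (diag_act act).
Proof.
move=> flow; split; first by move=> [x y]; rewrite /diag_act !(semiflow1 flow).
split=> [s t x|t]; first by rewrite /diag_act (semiflowM flow).
have ct := semiflow_continuous flow (t := t).
apply: continuous_pair; first exact: continuous_compT (@continuous_fst _ _) ct.
exact: continuous_compT (@continuous_snd _ _) ct.
Qed.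

Lemma RP_rel_orbit_graph (T : Type) (X : topologicalType) (act : T -> X -> X)
    (L : set (X * X)) (p : X * X) :
  RP_rel act L p ->
  exists x, closure (orbit_graph (diag_act act) L) (p, (x, x)).
Proof.
move=> [_ [F [PF [FL [Fp [[x x'] /[swap] Ft]]]]]].
rewrite /sf_diagonal /= => xx'; subst x'; exists x => A nA.
have : F [set q | A (q.1, diag_act act q.2 q.1)] by exact: (cvg_pair Fp Ft nA).
move=> /(filterI FL)/filter_ex[[y t] [Ly Ay]]; exists (y, diag_act act t y).
by split=> //; exists y => //; exists t.
Qed.

Section Ellis.
Context (T : Type) (mul : T -> T -> T) (e : T) (X : topologicalType).
Context (act : T -> X -> X).
Hypothesis flow : semiflow mul e act.
Hypothesis hX : hausdorff_space X.
Hypothesis cX : compact [set: X].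

Local Notation XX := {ptws X -> X}.

Let hXX : hausdorff_space XX := hausdorff_ptws hX.

Let cXX : compact [set: XX] := compact_ptws cX.

Lemma comp_right_continuous (g : X -> X) : continuous (fun f : XX => f \o g : XX).
Proof. by apply: continuous_ptws => x; exact: ptws_eval_continuous. Qed.

Lemma comp_act_continuous t : continuous (fun f : XX => act t \o f : XX).
Proof.
apply: continuous_ptws => x.
exact: continuous_compT (@ptws_eval_continuous X X x)
  (semiflow_continuous flow (t := t)).
Qed.

Definition ellis : set XX := closure (range (act : T -> XX)).

Definition left_ideal (J : set XX) : Prop :=
  closed J /\ forall t f, J f -> J (act t \o f).

Definition minimal_ideal (J : set XX) : Prop :=
  [/\ left_ideal J, J `<=` ellis, J !=set0 &
    forall K, left_ideal K -> K !=set0 -> K `<=` J -> K = J].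

Lemma ellis_act t : ellis (act t).
Proof. by apply: subset_closure; exists t. Qed.

Lemma ellis_sub_closed (A : set XX) :
  closed A -> (forall t, A (act t)) -> ellis `<=` A.
Proof. by move=> cA Aact; apply: closure_sub_closed => // _ [t _ <-]. Qed.

Lemma ellis_left_ideal : left_ideal ellis.
Proof.
split=> // [|t f]; first exact: closed_closure.
apply: (@ellis_sub_closed ((fun f : XX => act t \o f : XX) @^-1` ellis)).
  apply: (continuous_closedP _).1; first exact: comp_act_continuous.
  exact: closed_closure.
by move=> s; rewrite /preimage /= -(semiflowM flow); exact: ellis_act.
Qed.

Lemma left_ideal_comp J f g : left_ideal J -> ellis f -> J g -> J (f \o g).
Proof.
move=> [cJ actJ] Ef Jg.
apply: (ellis_sub_closed (A := (fun f : XX => f \o g : XX) @^-1` J)) Ef.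
  by apply: (continuous_closedP _).1 => //; exact: comp_right_continuous.
by move=> t; exact: actJ.
Qed.

Lemma ellis_comp f g : ellis f -> ellis g -> ellis (f \o g).
Proof. exact: left_ideal_comp ellis_left_ideal. Qed.

Lemma exists_minimal_ideal : exists J, minimal_ideal J.
Proof.
have [B []//|F _ FQ|||J [lJ J0 JE Jmin]] :=
  @exists_minimal_closed XX left_ideal ellis cXX.
- split; first by apply: closed_bigI => B /FQ[].
  by move=> t f Ff B FB; apply: (FQ _ FB).2; exact: Ff.
- exact: ellis_left_ideal.
- by exists (act e); exact: ellis_act.
- by exists J.
Qed.

(* Ellis--Numakura: in a minimal closed subsemigroup [R], both [R u] and
   [{f in R | f u = u}] are closed subsemigroups, hence equal to [R]. *)
Lemma exists_idempotent (S : set XX) :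
  closed S -> S !=set0 -> (forall f g, S f -> S g -> S (f \o g)) ->
  exists2 u, S u & u \o u = u.
Proof.
move=> cS S0 mS.
pose Q (A : set XX) := closed A /\ forall f g, A f -> A g -> A (f \o g).
have [B []//|F _ FQ|||R [[cR mR] [u Ru] RS Rmin]] :=
  @exists_minimal_closed XX Q S cXX.
- split; first by apply: closed_bigI => B /FQ[].
  by move=> f g Ff Fg B FB; apply: (FQ _ FB).2; [exact: Ff|exact: Fg].
- by [].
- by [].
have Ru_eq : [set f \o u | f in R] = R.
  apply: Rmin; last by move=> _ [f Rf <-]; exact: mR.
    split.
      apply: compact_image_closed; [exact: hXX|exact: closed_compactT|].
      exact: comp_right_continuous.
    move=> _ _ [f Rf <-] [g Rg <-]; exists (f \o u \o g) => //.
    by apply: (mR _ g) => //; exact: mR.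
  by exists (u \o u), u.
have fix_eq : R `&` [set f : XX | f \o u = u] = R.
  apply: Rmin; last by move=> f [].
    split.
      apply: closedI => //.
      apply: (continuous_closedP (fun f : XX => f \o u : XX)).1 [set u] _.
        exact: comp_right_continuous.
      exact/accessible_closed_set1/hausdorff_accessible/hXX.
    by move=> f g [Rf fu] [Rg gu]; split; [exact: mR|rewrite /= -compA gu].
  by move: (Ru); rewrite -{1}Ru_eq => -[f Rf fu]; exists f.
by exists u; [exact: RS|move: Ru; rewrite -{1}fix_eq => -[]].
Qed.

Section MinimalIdeal.
Context (I : set XX).
Hypothesis mI : minimal_ideal I.

Lemma minimal_ideal_closed : closed I.
Proof. by case: mI => -[]. Qed.

Lemma minimal_ideal_ellis : I `<=` ellis.
Proof. by case: mI. Qed.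

Lemma minimal_ideal_comp f g : ellis f -> I g -> I (f \o g).
Proof. by case: mI => lI _ _ _; exact: left_ideal_comp. Qed.

Lemma minimal_ideal_div f g : I f -> I g -> exists2 h, ellis h & h \o f = g.
Proof.
case: mI => _ _ _ Imin If Ig.
suff EI : [set h \o f | h in ellis] = I.
  by move: Ig; rewrite -EI => -[h]; exists h.
apply: Imin; last by move=> _ [h Eh <-]; exact: minimal_ideal_comp.
  split.
    apply: compact_image_closed.
    - exact: hXX.
    - by apply: closed_compactT cXX _; exact: closed_closure.
    - exact: comp_right_continuous.
  by move=> t _ [h Eh <-]; exists (act t \o h) => //; apply: ellis_left_ideal.2.
by exists (act e \o f), (act e) => //; exact: ellis_act.
Qed.

Lemma idempotent_right_unit f u : I u -> u \o u = u -> I f -> f \o u = f.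
Proof.
by move=> Iu uu If; have [h _ <-] := minimal_ideal_div Iu If; rewrite -compA uu.
Qed.

Lemma minimal_ideal_left_inverse f u : I u -> u \o u = u -> I f ->
  exists c, [/\ I c, u \o c = c & c \o f = u].
Proof.
move=> Iu uu If; have Eu := minimal_ideal_ellis Iu.
have [h Eh huf] := minimal_ideal_div (minimal_ideal_comp Eu If) Iu.
exists (u \o h \o u); split.
- by apply: minimal_ideal_comp Iu; exact: ellis_comp.
- by rewrite -[LHS]/((u \o u) \o (h \o u)) uu.
- by rewrite -[LHS]/(u \o (h \o (u \o f))) huf.
Qed.

(* [c] is the inverse of [u f] in the group [u I]. *)
Lemma minimal_ideal_inverse f u : I u -> u \o u = u -> I f ->
  exists c, [/\ I c, u \o c = c, c \o f = u & u \o f \o c = u].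
Proof.
move=> Iu uu If.
have [c [Ic uc cf]] := minimal_ideal_left_inverse Iu uu If.
have [d [Id _ dc]] := minimal_ideal_left_inverse Iu uu Ic.
exists c; split=> //.
suff -> : u \o f = d by [].
by rewrite -[in LHS]dc -[LHS]/(d \o (c \o f)) cf (idempotent_right_unit Iu).
Qed.

End MinimalIdeal.

Definition ellis_action (Z : topologicalType) (actZ : T -> Z -> Z)
    (app : XX -> Z -> Z) : Prop :=
  [/\ forall f g z, app (f \o g) z = app f (app g z),
      forall t z, app (act t) z = actZ t z &
      forall z, continuous (app^~ z)].

Section EllisAction.
Context (Z : topologicalType) (actZ : T -> Z -> Z) (app : XX -> Z -> Z).
Hypothesis hZ : hausdorff_space Z.
Hypothesis cZ : compact [set: Z].
Hypothesis appP : ellis_action actZ app.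

Let app_comp f g z : app (f \o g) z = app f (app g z).
Proof. by case: appP. Qed.

Let app_act t z : app (act t) z = actZ t z.
Proof. by case: appP. Qed.

Let app_continuous z : continuous (app^~ z).
Proof. by case: appP. Qed.

Lemma app_act_continuous t z : continuous (fun f : XX => app (act t \o f) z).
Proof.
exact: continuous_compT (@comp_act_continuous t) (@app_continuous z).
Qed.

Lemma ellis_invariant (N : set Z) f z :
  closed N -> sf_invariant actZ N -> ellis f -> N z -> N (app f z).
Proof.
move=> cN iN Ef Nz.
apply: (ellis_sub_closed (A := app^~ z @^-1` N)) Ef.
  exact: (continuous_closedP _).1.
by move=> t; rewrite /preimage /= app_act; exact: iN.
Qed.

Lemma ellis_approx (O : set Z) f z :
  open O -> ellis f -> O (app f z) -> exists t, O (actZ t z).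
Proof.
move=> oO Ef Of; have [|_ [[t _ <-]] Ot] := Ef [set f : XX | O (app f z)].
  by apply: app_continuous; exact: open_nbhs_nbhs.
by exists t; rewrite -app_act.
Qed.

Lemma minimal_ideal_orbit_closed I z : minimal_ideal I ->
  closed [set app f z | f in I].
Proof.
move=> mI; apply: compact_image_closed => //.
exact: closed_compactT cXX (minimal_ideal_closed mI).
Qed.

Lemma minimal_ideal_orbit_invariant I z : minimal_ideal I ->
  sf_invariant actZ [set app f z | f in I].
Proof.
move=> mI t _ [f If <-]; exists (act t \o f); last by rewrite app_comp app_act.
by apply: minimal_ideal_comp => //; exact: ellis_act.
Qed.

Lemma minimal_ideal_transitive I y z : minimal_ideal I -> sf_minimal actZ ->
  exists2 f, I f & app f y = z.
Proof.
move=> mI minZ; suff : [set app f y | f in I] z by case=> f; exists f.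
rewrite (minZ [set app f y | f in I]) //.
- exact: minimal_ideal_orbit_closed.
- exact: minimal_ideal_orbit_invariant.
- by have [_ _ [f If] _] := mI; exists (app f y), f.
Qed.

Lemma ap_point_minimal_ideal_orbit I z : minimal_ideal I ->
  ap_point mul actZ z -> exists2 f, I f & app f z = z.
Proof.
move=> mI apz; have [_ _ [f If] _] := mI.
suff : [set app f z | f in I] z by case=> g; exists g.
have -> := (closure_id _).1 (@minimal_ideal_orbit_closed I z mI).
move=> U /(@compact_regular _ z setT hZ cZ filterT)[V /apz[K [fK KV]] VU].
suff [k Kk Vk] : (\bigcup_(k in K) [set f | closure V (app (act k \o f) z)]) f.
  exists (app (act k \o f) z); split; last exact: VU.
  by exists (act k \o f) => //; apply: minimal_ideal_comp => //; exact: ellis_act.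
apply: ellis_sub_closed (minimal_ideal_ellis mI If).
  apply: (@closed_bigcup _ {classic T}) => // k Kk.
  have /continuous_closedP := @app_act_continuous k z; apply.
  exact: closed_closure.
move=> t; have [k Kk Vk] := KV t; exists k => //=; apply: subset_closure.
by rewrite -(semiflowM flow) app_act.
Qed.

Lemma ap_point_idempotent I z : minimal_ideal I ->
  ap_point mul actZ z -> exists u, [/\ I u, u \o u = u & app u z = z].
Proof.
move=> mI apz.
have [||f g [If fz] [Ig gz]|u [Iu uz] uu] :=
  @exists_idempotent (I `&` [set f : XX | app f z = z]).
- apply: closedI; first exact: minimal_ideal_closed.
  apply: (continuous_closedP (app^~ z)).1 [set z] _ => //.
  exact/accessible_closed_set1/hausdorff_accessible.
- by have [f If fz] := ap_point_minimal_ideal_orbit mI apz; exists f.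
- split; last by rewrite /= app_comp gz.
  by apply: minimal_ideal_comp => //; exact: minimal_ideal_ellis mI _ If.
- by exists u.
Qed.

Lemma fixed_ap_point I u z : minimal_ideal I -> I u -> app u z = z ->
  ap_point mul actZ z.
Proof.
move=> mI Iu uz U; rewrite nbhsE => -[G [oG Gz] GU].
have cI := closed_compactT cXX (minimal_ideal_closed mI).
have [|f If|K fK KG] := @compact_finite_subcover XX T
  (fun t => [set f | G (app (act t \o f) z)]) I cI.
- by move=> t; have /continuousP/(_ _ oG) := @app_act_continuous t z.
- have [h Eh hf] := minimal_ideal_div mI If Iu.
  have [|t Gt] := @ellis_approx G h (app f z) oG Eh.
    by rewrite -app_comp hf uz.
  by exists t => //; rewrite /= app_comp app_act.
exists K; split=> // t.
have [|k Kk Gk] := KG (act t \o u).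
  by apply: minimal_ideal_comp => //; exact: ellis_act.
exists k => //; apply: GU; move: Gk.
by rewrite /= -app_act (semiflowM flow) compA app_comp uz.
Qed.

Lemma ap_point_closed_invariant (N : set Z) f z :
  closed N -> sf_invariant actZ N -> ap_point mul actZ z ->
  ellis f -> N (app f z) -> N z.
Proof.
move=> cN iN apz Ef Nfz.
have [I mI] := exists_minimal_ideal.
have [u [Iu _ uz]] := ap_point_idempotent mI apz.
have [h Eh hfu] := minimal_ideal_div mI (minimal_ideal_comp mI Ef Iu) Iu.
have <- : app h (app f z) = z by rewrite -{1}uz -(app_comp f) -app_comp hfu uz.
exact: ellis_invariant.
Qed.

End EllisAction.

Definition pair_app (f : X -> X) (p : X * X) : X * X := (f p.1, f p.2).

Lemma eval_ellis_action : ellis_action act (fun (f : XX) x => f x).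
Proof. by split=> //; exact: ptws_eval_continuous. Qed.

Lemma pair_ellis_action : ellis_action (diag_act act) pair_app.
Proof. by split=> // z; apply: continuous_pair; exact: ptws_eval_continuous. Qed.

Lemma eval_fst_continuous x : continuous (fun y : XX * X => (y.1 x, y.2)).
Proof.
apply: continuous_pair; last exact: continuous_snd.
exact: continuous_compT (@continuous_fst _ _) (@ptws_eval_continuous X X x).
Qed.

Let hX2 : hausdorff_space (X * X)%type := hausdorff_prod hX hX.

Let cX2 : compact [set: X * X] := compact_prod cX cX.

Section TransitiveRelation.
Context (Y : topologicalType) (pi : X -> Y) (L : set (X * X)).
Hypothesis mX : sf_minimal act.
Hypothesis iL : sf_invariant (diag_act act) L.
Hypothesis cL : closed L.
Hypothesis tL : AP_transitive mul act pi L.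
Hypothesis dL : dense_ap_on mul (diag_act act) L.
Hypothesis rpL : RP_rel act L = L.

Local Notation ap := (ap_point mul (diag_act act)).

Lemma pair_ellis_invariant (N : set (X * X)) f p :
  closed N -> sf_invariant (diag_act act) N -> ellis f -> N p -> N (pair_app f p).
Proof. exact: (ellis_invariant pair_ellis_action). Qed.

Lemma RP_rel_orbit_graph_diag (D : set (X * X)) q z :
  L `<=` closure D -> L (q, z) ->
  closure (orbit_graph (diag_act act) D) ((q, z), (q, q)).
Proof.
move=> LD; rewrite -{1}rpL => /RP_rel_orbit_graph[x clx].
have [I mI] := exists_minimal_ideal.
have [f If fx] := minimal_ideal_transitive hX eval_ellis_action x q mI mX.
apply: (closure_orbit_graph_closure (diag_semiflow flow)).
apply: (closureS (A := orbit_graph (diag_act act) L)).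
  by move=> _ [y Ly [t _ <-]]; exists y; [exact: LD|exists t].
have -> : (q, q) = pair_app f (x, x) by rewrite /pair_app /= fx.
pose N := [set y | closure (orbit_graph (diag_act act) L) ((q, z), y)].
apply: (@pair_ellis_invariant N) => //; last exact: minimal_ideal_ellis mI _ If.
  have /continuous_closedP : continuous (pair (q, z) : X * X -> _).
    by apply: continuous_pair => y; [exact: cvg_cst|exact: cvg_id].
  by apply; exact: closed_closure.
exact: closure_orbit_graph_invariant (diag_semiflow flow) _ _.
Qed.

Section FixedPoints.
Context (I : set XX) (u : XX).
Hypothesis mI : minimal_ideal I.
Hypothesis Iu : I u.
Hypothesis uu : u \o u = u.

Let IE : I `<=` ellis := minimal_ideal_ellis mI.

Lemma idempotent_fixed x : u (u x) = u x.
Proof. by rewrite -[LHS]/((u \o u) x) uu. Qed.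

Lemma fixed_pair_ap_point a b : u a = a -> u b = b -> ap (a, b).
Proof.
move=> ua ub; apply: (fixed_ap_point pair_ellis_action mI Iu).
by rewrite /pair_app /= ua ub.
Qed.

Lemma AP_transitive_fixed a b c : u a = a -> u b = b -> u c = c ->
  L (a, b) -> L (b, c) -> L (a, c).
Proof.
move=> ua ub uc Lab Lbc; case: tL => _ [_ [_ [_ trans]]].
by apply: (trans a b c) => //; exact: fixed_pair_ap_point.
Qed.

Lemma ap_pair_lift q s : u q = q -> L s -> ap s ->
  exists g w, [/\ I g, u w = w, L (q, w) & pair_app g (q, w) = s].
Proof.
case: s => a b uq Lab apab.
have [k [Ik kk [ka kb]]] :=
  ap_point_idempotent hX2 cX2 pair_ellis_action mI apab.
have [f If fq] := minimal_ideal_transitive hX eval_ellis_action q a mI mX.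
pose g := k \o f.
have Ig : I g by apply: minimal_ideal_comp => //; exact: IE.
have gq : g q = a by rewrite /g /= fq.
have [c [Ic uc cg ugc]] := minimal_ideal_inverse mI Iu uu Ig.
have ku : k \o u = k by exact: (idempotent_right_unit mI Iu uu Ik).
have gcb : g (c b) = b.
  have <- : k \o u \o g = g by rewrite ku /g compA kk.
  by rewrite -[LHS]/(k ((u \o g \o c) b)) ugc -[LHS]/((k \o u) b) ku.
exists g, (c b); split=> //; last by rewrite /pair_app /= gq gcb.
  by rewrite -[LHS]/((u \o c) b) uc.
have -> : (q, c b) = pair_app c (a, b).
  by rewrite /pair_app /= -gq -[c (g q)]/((c \o g) q) cg uq.
by apply: pair_ellis_invariant => //; exact: IE.
Qed.

(* Evaluating [x.1.1] and [x.2.1] at [q] maps this set into the orbit graph of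
   [L]; keeping the maps themselves is what gives limits in the compact [I]. *)
Definition lifted_orbit_graph (q : X) : set ((XX * X) * (XX * X)) :=
  [set x | exists g w t, [/\ I g, u w = w, L (q, w) &
    x = ((g, g w), (act t \o g, act t (g w)))]].

Lemma closure_lifted_orbit_graph q :
  closure (lifted_orbit_graph q) `<=` [set x | I x.1.1 /\ I x.2.1].
Proof.
apply: closure_sub_closed.
  have cI : closed I by exact: minimal_ideal_closed.
  have cproj (pr : (XX * X) * (XX * X) -> XX * X) : continuous pr ->
      closed [set x | I (pr x).1].
    move=> cpr; apply: (continuous_closedP (fst \o pr)).1 _ cI.
    exact: continuous_compT cpr (@continuous_fst _ _).
  by apply: closedI; apply: cproj; [exact: continuous_fst|exact: continuous_snd].
move=> _ [g [w [t [Ig _ _ ->]]]]; split=> //=.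
by apply: minimal_ideal_comp => //; exact: ellis_act.
Qed.

Lemma RP_rel_lift q z : u q = q -> L (q, z) ->
  exists r r', [/\ I r, I r', r q = q, r' q = q &
    closure (lifted_orbit_graph q) ((r, z), (r', q))].
Proof.
move=> uq Lqz.
have [D [DL [Dap LD]]] := dL.
pose ev (x : (XX * X) * (XX * X)) := ((x.1.1 q, x.1.2), (x.2.1 q, x.2.2)).
have cev : continuous ev.
  have cq := @eval_fst_continuous q.
  apply: continuous_pair.
    exact: continuous_compT (@continuous_fst _ _) cq.
  exact: continuous_compT (@continuous_snd _ _) cq.
have Dlift : orbit_graph (diag_act act) D `<=` ev @` lifted_orbit_graph q.
  move=> _ [s Ds [t _ <-]].
  have [g [w [Ig uw Lqw <-]]] := ap_pair_lift uq (DL _ Ds) (Dap _ Ds).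
  by exists ((g, g w), (act t \o g, act t (g w))) => //; exists g, w, t.
have [||[[r z'] [r' q']] clr [rq z'E r'q q'E]] :=
  closure_image_subset _ _ cev (closureS Dlift (RP_rel_orbit_graph_diag LD Lqz)).
- exact: hausdorff_prod hX2 hX2.
- by apply: compact_prod; exact: compact_prod cXX cX.
- rewrite z'E q'E in clr; have [Ir Ir'] := closure_lifted_orbit_graph clr.
  by exists r, r'.
Qed.

Lemma closed_invariant_lifted_limit N G q a s r z r' y :
  closed N -> sf_invariant (diag_act act) N -> open G -> G `&` L `<=` N ->
  u q = q -> u a = a -> L (a, q) ->
  closure (lifted_orbit_graph q) ((r, z), (r', y)) ->
  G (diag_act act s (r' a, y)) -> N (r a, z).
Proof.
move=> cN iN oG GN uq ua Laq clr Gs.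
have ca := @eval_fst_continuous a.
pose O := [set x : (XX * X) * (XX * X) | G (diag_act act s (x.2.1 a, x.2.2))].
have oO : open O.
  have := continuous_compT (continuous_compT (@continuous_snd (XX * X)%type _) ca)
    (semiflow_continuous (diag_semiflow flow) (t := s)).
  by move=> /continuousP/(_ _ oG).
pose M := [set x : (XX * X) * (XX * X) | N (x.1.1 a, x.1.2)].
have cM : closed M.
  have := continuous_compT (@continuous_fst _ (XX * X)%type) ca.
  by move=> /continuous_closedP/(_ _ cN).
suff OM : lifted_orbit_graph q `&` O `<=` M.
  exact: (closure_sub_closed cM OM (closure_open_setI oO clr Gs)).
move=> _ [[g [w [t [Ig uw Lqw ->]]]] Gst].
have Law : L (a, w) by exact: AP_transitive_fixed Laq Lqw.
have Em : ellis (act s \o (act t \o g)).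
  by do 2?[apply: ellis_comp; first exact: ellis_act]; exact: IE.
apply: (pair_ellis_invariant (p := (a, w))) => //; first exact: IE.
apply: (ap_point_closed_invariant hX2 cX2 pair_ellis_action cN iN _ Em);
  first exact: fixed_pair_ap_point.
by apply: GN; split; [exact: Gst|exact: pair_ellis_invariant].
Qed.

Lemma closed_invariant_fixed_pair N G p q z :
  closed N -> sf_invariant (diag_act act) N -> open G -> G `&` L `<=` N ->
  u p = p -> u q = q -> u z = z -> G (p, q) -> L (p, q) -> L (q, z) ->
  N (p, z).
Proof.
move=> cN iN oG GN up uq uz Gpq Lpq Lqz.
have [r [r' [Ir Ir' rq r'q clr]]] := RP_rel_lift uq Lqz.
have [c [Ic uc cr urc]] := minimal_ideal_inverse mI Iu uu Ir.
have cq : c q = q by rewrite -{1}rq -[LHS]/((c \o r) q) cr.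
have ucp : u (c p) = c p by rewrite -[LHS]/((u \o c) p) uc.
have Lcpq : L (c p, q).
  by have := pair_ellis_invariant cL iL (IE Ic) Lpq; rewrite /pair_app /= cq.
have Ir'c : I (r' \o c) by apply: minimal_ideal_comp => //; exact: IE.
have [h Eh hr'c] := minimal_ideal_div mI Ir'c Iu.
have [s Gs] : exists s, G (diag_act act s (r' (c p), q)).
  apply: (ellis_approx pair_ellis_action oG Eh).
  have -> : (r' (c p), q) = pair_app (r' \o c) (p, q).
    by rewrite /pair_app /= cq r'q.
  rewrite -[pair_app h _]/(pair_app (h \o (r' \o c)) (p, q)) hr'c.
  by rewrite /pair_app /= up uq.
have /(pair_ellis_invariant cN iN (IE Iu)) :=
  closed_invariant_lifted_limit cN iN oG GN uq ucp Lcpq clr Gs.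
by rewrite /pair_app /= uz -[u (r (c p))]/((u \o r \o c) p) urc up.
Qed.

End FixedPoints.

Lemma closed_invariant_with_interior N G :
  closed N -> sf_invariant (diag_act act) N -> open G -> G `&` L !=set0 ->
  G `&` L `<=` N -> L `<=` N.
Proof.
move=> cN iN oG [x [Gx Lx]] GN.
have [D [DL [Dap LD]]] := dL.
have [[p q] [Dpq Gpq]] := LD _ Lx G (open_nbhs_nbhs (conj oG Gx)).
have [I mI] := exists_minimal_ideal.
have [u [Iu uu [up uq]]] :=
  ap_point_idempotent hX2 cX2 pair_ellis_action mI (Dap _ Dpq).
suff DN : D `<=` N by move=> y /LD; exact: closure_sub_closed.
move=> [x1 x2] Dx.
have [f If fx] := minimal_ideal_transitive hX eval_ellis_action x1 p mI mX.
have Euf : ellis (u \o f) by apply: ellis_comp; exact: (minimal_ideal_ellis mI).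
apply: (ap_point_closed_invariant hX2 cX2 pair_ellis_action cN iN (Dap _ Dx)
  Euf).
pose z := u (f x2).
have uz : u z = z by exact: idempotent_fixed.
have fxE : pair_app (u \o f) (x1, x2) = (p, z) by rewrite /pair_app /= fx up.
have Lpz : L (p, z).
  by rewrite -fxE; apply: pair_ellis_invariant => //; exact: DL.
have Lpq : L (p, q) by exact: DL.
have Lqz : L (q, z).
  apply: (AP_transitive_fixed mI Iu uq up uz _ Lpz).
  by case: tL => _ [_ [_ [sym _]]]; exact: sym.
rewrite fxE.
exact: (closed_invariant_fixed_pair mI Iu uu cN iN oG GN up uq uz Gpq Lpq Lqz).
Qed.

End TransitiveRelation.
End Ellis.

Theorem theorem2p2 (T : Type) (mul : T -> T -> T) (e : T)
  (X Y : topologicalType) (actX : T -> X -> X) (actY : T -> Y -> Y)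
  (pi : X -> Y) (L : set (X * X)) :
  monoid_axioms mul e ->
  hausdorff_space X -> compact [set: X] ->
  hausdorff_space Y -> compact [set: Y] ->
  semiflow mul e actX -> semiflow mul e actY ->
  sf_minimal actX -> sf_minimal actY ->
  sf_extension actX actY pi ->
  closed L -> sf_invariant (diag_act actX) L ->
  AP_transitive mul actX pi L ->
  dense_ap_on mul (diag_act actX) L ->
  RP_rel actX L = L ->
  M_semiflow_on mul (diag_act actX) L.
Proof.
move=> _ hX cX _ _ flow _ mX _ _ cL iL tL dL rpL; split=> //.
apply: (top_transitive_on_closed_invariant (diag_semiflow flow) iL) => N G.
exact: (closed_invariant_with_interior flow hX cX mX iL cL tL dL rpL).
Qed.
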